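(* Let $T\in\mathcal{B}(\mathcal{H})$ be a contraction, let $Q$ be an isometry on $\mathcal{H}$, and let $X\in\mathcal{B}(\mathcal{H})$ be such that $TX=QXT$. Let $V\in\mathcal{B}(\mathcal{K})$, $\mathcal{K}\supseteq\mathcal{H}$, be any isometric lift of $T$. Then there is an isometric lift $\overline{Q}\in\mathcal{B}(\mathcal{K})$ of $Q$ and a norm preserving lift $\widetilde{X}\in\mathcal{B}(\mathcal{K})$ of $X$ such that $V\widetilde{X}=\overline{Q}\widetilde{X}V$. Moreover, for any complex number $q$ of modulus one, $\overline{Q}$ can be chosen to be $\overline{Q}=Q\oplus qI$ with respect to the decomposition $\mathcal{K}=\mathcal{H}\oplus\mathcal{H}^{\perp}$.
   Context: All Hilbert spaces are complex; $\mathcal{B}(\mathcal{H})$ is the algebra of bounded linear operators on $\mathcal{H}$; $\mathcal{H}\subseteq\mathcal{K}$ means $\mathcal{H}$ is a closed linear subspace of $\mathcal{K}$; a contraction is an operator of norm at most one. An operator $B\in\mathcal{B}(\mathcal{K})$ is a lift of $A\in\mathcal{B}(\mathcal{H})$, $\mathcal{H}\subseteq\mathcal{K}$, if $\mathcal{H}$ is invariant under $B^*$ and $B^*|_{\mathcal{H}}=A^*$. It is an isometric lift if in addition $B$ is an isometry, and a norm preserving lift if in addition $\|B\|=\|A\|$. *)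

(* Defs.v *)
From HB Require Import structures.
From mathcomp Require Import all_boot all_order all_algebra.
From mathcomp Require Import sesquilinear complex ring lra.
From mathcomp Require Import all_classical all_reals all_analysis.

Set Implicit Arguments.
Unset Strict Implicit.
Unset Printing Implicit Defensive.

Import Order.TTheory GRing.Theory Num.Theory.
Import numFieldNormedType.Exports.

Local Open Scope classical_set_scope.
Local Open Scope ring_scope.
Local Open Scope complex_scope.

HB.mixin Record CompleteNormedModule_isHilbert (R : realType) H
    & CompleteNormedModule R[i] H := {
  hdot : H -> H -> R[i] ;
  hdotPl : forall (a : R[i]) (x y z : H),
    hdot (a *: x + y) z = a * hdot x z + hdot y z ;
  hdotC : forall x y : H, hdot y x = (hdot x y)^* ;
  hdotE : forall x : H, hdot x x = `|x| ^+ 2 }.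

#[short(type="hilbertType")]
HB.structure Definition Hilbert (R : realType) :=
  {H of CompleteNormedModule_isHilbert R H & CompleteNormedModule R[i] H}.

Section hilbert_theory.
Context {R : realType} {H : hilbertType R}.
Implicit Types (x y w : H).

(* Norms of a normed module over R[i] are (real) elements of R[i]. *)
Definition hnorm x : R := complex.Re `|x|.

Lemma hnormE x : `|x| = (hnorm x)%:C.
Proof. by rewrite /hnorm RRe_real ?ger0_real ?normr_ge0. Qed.

Lemma hnorm_ge0 x : 0 <= hnorm x.
Proof. by rewrite -lecR -hnormE rmorph0 normr_ge0. Qed.

Lemma hdotDl x y w : hdot (x + y) w = hdot x w + hdot y w.
Proof. by have := hdotPl 1 x y w; rewrite scale1r mul1r. Qed.

Lemma hdot0l w : hdot 0 w = 0 :> R[i].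
Proof. by apply: (addrI (hdot 0 w)); rewrite -hdotDl !addr0. Qed.

Lemma hdotZl a x y : hdot (a *: x) y = a * hdot x y.
Proof. by have := hdotPl a x 0 y; rewrite hdot0l !addr0. Qed.

Lemma hdotNl x y : hdot (- x) y = - hdot x y.
Proof. by rewrite -scaleN1r hdotZl mulN1r. Qed.

Lemma hdotBl x y w : hdot (x - y) w = hdot x w - hdot y w.
Proof. by rewrite hdotDl hdotNl. Qed.

Lemma hdotDr x y w : hdot w (x + y) = hdot w x + hdot w y.
Proof. by rewrite hdotC hdotDl rmorphD /= -!hdotC. Qed.

Lemma hdotZr a x y : hdot x (a *: y) = a^* * hdot x y.
Proof. by rewrite hdotC hdotZl rmorphM /= -hdotC. Qed.

Lemma hdot0r w : hdot w 0 = 0 :> R[i].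
Proof. by rewrite hdotC hdot0l rmorph0. Qed.

Lemma hdotNr x y : hdot x (- y) = - hdot x y.
Proof. by rewrite hdotC hdotNl rmorphN /= -hdotC. Qed.

Lemma hdotBr x y w : hdot w (x - y) = hdot w x - hdot w y.
Proof. by rewrite hdotDr hdotNr. Qed.

Lemma hdotxx_gt0 x : x != 0 -> 0 < hdot x x.
Proof. by move=> x0; rewrite hdotE exprn_gt0// normr_gt0. Qed.

HB.instance Definition _ := bilinear_isBilinear.Build R[i] H H R[i]
  *%R (Num.conj \; *%R) (@hdot R H)
  (fun z a x y => hdotPl a x y z,
   fun z a x y => etrans (hdotDr (a *: x) y z)
     (congr1 (fun u => u + _) (hdotZr a z x))).

HB.instance Definition _ := isHermitianSesquilinear.Build R[i] H false Num.conj
  (@hdot R H) (fun x y => etrans (hdotC y x) (esym (mul1r _))).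

HB.instance Definition _ := isDotProduct.Build R[i] H (@hdot R H) hdotxx_gt0.

Lemma hdot_ReC x y : complex.Re (hdot y x) = complex.Re (hdot x y).
Proof. by rewrite hdotC; case: (hdot x y). Qed.

Lemma hnorm_sqrD x y :
  hnorm (x + y) ^+ 2 =
  hnorm x ^+ 2 + hnorm y ^+ 2 + 2 * complex.Re (hdot x y).
Proof.
apply: (@complexI R).
have E : hdot (x + y) (x + y) =
    hdot x x + hdot y y + (hdot x y + (hdot x y)^*).
  rewrite hdotDl !hdotDr (hdotC x y) /= -!addrA; congr (_ + _).
  by rewrite addrA addrC.
move: E; rewrite addcJ !hdotE !hnormE -!rmorphXn /= => ->.
by rewrite !rmorphD /= [in RHS](rmorphM _ 2) rmorph_nat.
Qed.

Lemma hnormZr (t : R) x : hnorm (t%:C *: x) = `|t| * hnorm x.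
Proof.
apply: (@complexI R); rewrite -hnormE normrZ hnormE rmorphM/=.
by congr (_ * _); rewrite normc_def/= expr0n/= addr0 sqrtr_sqr.
Qed.

Lemma hnormN x : hnorm (- x) = hnorm x.
Proof. by rewrite /hnorm normrN. Qed.

Lemma Cauchy_Schwarz x y : `|hdot x y| <= `|x| * `|y|.
Proof.
have [->|y0] := eqVneq y 0; first by rewrite hdot0r !normr0 mulr0.
have ny0 : 0 < `|y| by rewrite normr_gt0.
pose a := hdot x y / `|y| ^+ 2.
have nya : hdot (x - a *: y) y = 0.
  by rewrite hdotBl hdotZl hdotE divfK ?subrr// expf_neq0// gt_eqF.
have xE : `|x| ^+ 2 = `|x - a *: y| ^+ 2 + `|a * `|y| | ^+ 2.
  rewrite normrM normr_id -normrZ -!hdotE.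
  rewrite -(@hnormDd _ _ _ _ (@hdot R H)) ?subrK// [LHS]hdotZr nya mulr0 //.
have : `|a * `|y| | ^+ 2 <= `|x| ^+ 2 by rewrite xE lerDr exprn_ge0.
rewrite ler_pXn2r ?nnegrE//.
rewrite normrM normf_div normrX !normr_id.
by rewrite expr2 invfM mulrA divfK ?gt_eqF// ler_pdivrMr.
Qed.

Lemma Re_hdot_le x y : `|complex.Re (hdot x y)| <= hnorm x * hnorm y.
Proof.
rewrite -lecR; apply: le_trans (normc_ge_Re _) _.
by rewrite rmorphM/= -!hnormE; exact: Cauchy_Schwarz.
Qed.

Lemma hdot_injr x y : (forall w, hdot w x = hdot w y) -> x = y.
Proof.
move=> xy; have : hdot (x - y) (x - y) = 0 by rewrite hdotBr xy subrr.
by rewrite hdotE => /eqP; rewrite expf_eq0 normr_eq0 subr_eq0 => /eqP.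
Qed.

Lemma riesz (f : H -> R[i]) (M : R) :
  (forall a x y, f (a *: x + y) = a * f x + f y) ->
  (forall x, `|f x| <= M%:C * `|x|) ->
  exists z, forall x, f x = hdot x z.
Proof.
move=> flin fM.
have f0 : f 0 = 0.
  by apply: (addrI (f 0)); have := flin 1 0 0; rewrite scale1r mul1r !addr0.
have fD x y : f (x + y) = f x + f y by have := flin 1 x y; rewrite scale1r mul1r.
have fZ a x : f (a *: x) = a * f x by have := flin a x 0; rewrite addr0 f0 addr0.
pose phi x := hnorm x ^+ 2 - 2 * complex.Re (f x).
have phi_ge x : - (M ^+ 2) <= phi x.
  have : complex.Re (f x) <= M * hnorm x.
    apply: le_trans (ler_norm _) _; rewrite -lecR.
    by apply: le_trans (normc_ge_Re _) _; rewrite rmorphM/= -hnormE.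
  by move=> h1; have h2 := sqr_ge0 (hnorm x - M); rewrite /phi; lra.
have phi_inf : has_inf (range phi).
  by split; [exists (phi 0), 0 | exists (- M ^+ 2) => _ [x _ <-]].
pose d := inf (range phi).
have d_le x : d <= phi x by apply: ge_inf; [exact: phi_inf.2 | exists x].
have dn n : exists x, phi x < d + n.+1%:R^-1.
  have n0 : 0 < n.+1%:R^-1 :> R by rewrite invr_gt0.
  by have [_ [x _ <-] ?] := inf_adherent n0 phi_inf; exists x.
have [u phiu] := choice dn.
have phiD x w : phi (x + w) = phi x + hnorm w ^+ 2
    + 2 * complex.Re (hdot x w) - 2 * complex.Re (f w).
  rewrite /phi hnorm_sqrD fD.
  have -> : complex.Re (f x + f w) = complex.Re (f x) + complex.Re (f w).
    by case: (f x); case: (f w).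
  lra.
have ReZ (t : R) z : complex.Re (t%:C * z) = t * complex.Re z.
  by case: z => a b /=; rewrite mul0r subr0.
have ReN z : complex.Re (- z) = - complex.Re z by case: z.
have phi_mid x y : hnorm (x - y) ^+ 2 <= 2 * phi x + 2 * phi y - 4 * d.
  pose h := (2^-1 : R)%:C *: (x - y).
  have hD : h + h = x - y.
    rewrite -scalerDl -rmorphD/=.
    have -> : 2^-1 + 2^-1 = 1 :> R by lra.
    by rewrite scale1r.
  have hN : hnorm (x - y) = 2 * hnorm h.
    by rewrite hnormZr ger0_norm ?invr_ge0// mulrA mulfV ?mul1r// pnatr_eq0.
  have := d_le (y + h).
  have := phiD (y + h) h; rewrite -addrA hD addrC subrK addrC.
  have := phiD (y + h) (- h); rewrite addrK hnormN hdotNr.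
  have -> : f (- h) = - f h by rewrite -scaleN1r fZ mulN1r.
  rewrite !ReN hN => h1 h2 h3; lra.
have inv_small (e : R) : 0 < e ->
    exists N, forall n, (N <= n)%N -> n.+1%:R^-1 < e.
  move=> e0; have [N _ hN] := near_infty_natSinv_lt (PosNum e0).
  by exists N => n Nn; exact: hN.
have ucvg : cvg (u @ \oo).
  apply: cauchy_cvg; apply: cauchy_exP => /= e e0.
  have eE : e = (complex.Re e)%:C by rewrite RRe_real// gtr0_real.
  have e0' : 0 < complex.Re e by rewrite -ltcR -eE.
  move: (complex.Re e) eE e0' => r eE r0.
  have r20 : 0 < r ^+ 2 / 4 by rewrite divr_gt0// exprn_gt0.
  have [N hN] := inv_small _ r20.
  exists (u N), N => // n /= Nn.
  rewrite -ball_normE /ball_/= hnormE eE ltcR.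
  rewrite -(@ltr_pXn2r _ 2%N) ?nnegrE ?hnorm_ge0 ?(ltW r0)//.
  apply: le_lt_trans (phi_mid _ _) _.
  have := phiu N; have := phiu n; have := hN _ (leqnn N); have := hN _ Nn.
  move: (N.+1%:R^-1) (n.+1%:R^-1) => iN i_n h1 h2 h3 h4; lra.
pose z := lim (u @ \oo).
have uz (e : R) : 0 < e ->
    exists N, forall n, (N <= n)%N -> hnorm (z - u n) < e.
  move=> e0; have e0' : 0 < e%:C by rewrite ltcR.
  have [N _ hN] := (@cvgrPdist_lt _ _ _ _ _ _ _).1 ucvg _ e0'.
  by exists N => n Nn; have := hN n Nn; rewrite /= hnormE ltcR.
have key w : 0 <= hnorm w ^+ 2 + 2 * (complex.Re (hdot z w) - complex.Re (f w)).
  rewrite leNgt; apply/negP.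
  move cE : (hnorm w ^+ 2 + _) => c neg.
  have w0 := hnorm_ge0 w.
  have c0 : 0 < - c / 4 by lra.
  have cw0 : 0 < - c / (4 * (hnorm w + 1)) by rewrite divr_gt0 ?oppr_gt0//; lra.
  have [N1 hN1] := inv_small _ c0.
  have [N2 hN2] := uz _ cw0.
  pose n := maxn N1 N2.
  have {}hN1 := hN1 n (leq_maxl _ _).
  have {}hN2 := hN2 n (leq_maxr _ _).
  have := d_le (u n + w); rewrite phiD.
  have := Re_hdot_le (z - u n) w; rewrite ler_norml => /andP[+ _].
  rewrite hdotBl.
  have -> : complex.Re (hdot z w - hdot (u n) w) =
      complex.Re (hdot z w) - complex.Re (hdot (u n) w).
    by case: (hdot z w); case: (hdot (u n) w).
  have := phiu n.
  have : hnorm (z - u n) * hnorm w <= - c / 4.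
    have -> : - c / 4 = - c / (4 * (hnorm w + 1)) * (hnorm w + 1).
      by field; rewrite gt_eqF//; lra.
    by apply: ler_pM; rewrite ?hnorm_ge0 ?(ltW hN2)//; lra.
  move: hN1 cE; move: (n.+1%:R^-1) => i_n hN1.
  move: (complex.Re (hdot z w)) (complex.Re (hdot (u n) w)) (complex.Re (f w)).
  move=> a1 a2 a3 cE h1 h2 h3 h4.
  suff : d < d by rewrite ltxx.
  lra.
exists z => x.
have Re0 w : complex.Re (f w - hdot w z) = 0.
  pose g := complex.Re (hdot z w) - complex.Re (f w).
  have gE : complex.Re (f w - hdot w z) = - g.
    rewrite /g (hdot_ReC w z).
    by case: (f w); case: (hdot w z) => a b c e /=; rewrite opprB.
  have gZ (t : R) : 0 <= t ^+ 2 * hnorm w ^+ 2 + 2 * (t * g).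
    have := key (t%:C *: w).
    rewrite hnormZr exprMn real_normK ?num_real// fZ ReZ.
    by rewrite hdot_ReC hdotZl ReZ (hdot_ReC z w) -mulrBr.
  rewrite gE; apply/eqP; rewrite oppr_eq0.
  have n1 : 0 < hnorm w ^+ 2 + 1 by rewrite ltr_wpDl// sqr_ge0.
  have := gZ (- g / (hnorm w ^+ 2 + 1)).
  have -> : (- g / (hnorm w ^+ 2 + 1)) ^+ 2 * hnorm w ^+ 2 +
      2 * (- g / (hnorm w ^+ 2 + 1) * g) =
      - (g ^+ 2 * ((hnorm w ^+ 2 + 2) / (hnorm w ^+ 2 + 1) ^+ 2)).
    by field; rewrite gt_eqF.
  rewrite oppr_ge0 pmulr_lle0; last first.
    by rewrite divr_gt0 ?exprn_gt0// ltr_wpDl// sqr_ge0.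
  by rewrite -[g == 0](expf_eq0 g 2) eq_le sqr_ge0 andbT.
apply/eqP; rewrite -subr_eq0; apply/eqP.
have := Re0 x; have := Re0 ('i%C *: x).
rewrite fZ hdotZl -mulrBr.
by case: (f x - hdot x z) => a b /=; rewrite mul0r mul1r sub0r => /eqP;
  rewrite oppr_eq0 => /eqP -> ->.
Qed.

End hilbert_theory.

(* The elements of B(H, K). *)
Record bop (R : realType) (H K : hilbertType R) := Bop {
  bop_fun :> {linear H -> K} ;
  bop_bounded : exists M : R, forall x, `|bop_fun x| <= M%:C * `|x| }.

Section operators.
Context {R : realType}.
Implicit Types H K : hilbertType R.

Lemma adj_exists H K (A : bop H K) :
  exists B : bop K H, forall x y, hdot (A x) y = hdot x (B y).
Proof.
have [M AM] := bop_bounded A.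
have /choice[B BP] : forall y, exists z, forall x, hdot (A x) y = hdot x z.
  move=> y; apply: (@riesz _ _ _ (M * hnorm y)) => [a x x'|x].
    by rewrite linearP hdotPl.
  apply: le_trans (Cauchy_Schwarz _ _) _.
  by rewrite (hnormE y) rmorphM/= mulrAC ler_wpM2r// ler0c hnorm_ge0.
have Blin : linear B.
  move=> a y y'; apply: hdot_injr => x.
  by rewrite -BP !hdotDr !hdotZr -!BP.
have Bbd : exists M : R, forall y, `|B y| <= M%:C * `|y|.
  exists `|M| => y; have [->|By0] := eqVneq (B y) 0.
    by rewrite normr0 mulr_ge0// ler0c.
  have By_gt0 : 0 < `|B y| by rewrite normr_gt0.
  rewrite -(ler_pM2l By_gt0) -expr2 -hdotE -BP.
  rewrite -[X in X <= _]ger0_norm; last by rewrite BP hdotE exprn_ge0.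
  apply: le_trans (Cauchy_Schwarz _ _) _.
  rewrite mulrA [`|B y| * _]mulrC ler_wpM2r//; apply: le_trans (AM _) _.
  by rewrite ler_wpM2r// lecR ler_norm.
pose BL : {linear K -> H} := HB.pack B (GRing.isLinear.Build _ _ _ _ _ Blin).
by exists (@Bop _ _ _ BL Bbd).
Qed.

Definition adj H K (A : bop H K) : bop K H := projT1 (cid (adj_exists A)).

Lemma adjP H K (A : bop H K) x y : hdot (A x) y = hdot x (adj A y).
Proof. exact: (projT2 (cid (adj_exists A)) x y). Qed.

Definition opnorm H K (A : bop H K) : R :=
  sup [set hnorm (A x) | x in [set x : H | `|x| <= 1]].

Lemma opnorm_has_sup H K (A : bop H K) :
  has_sup [set hnorm (A x) | x in [set x : H | `|x| <= 1]].
Proof.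
split; first by exists (hnorm (A 0)), 0 => //=; rewrite normr0.
have [M AM] := bop_bounded A; exists `|M| => _ [x /= x1 <-].
rewrite -lecR -hnormE; apply: le_trans (AM x) _.
rewrite hnormE -rmorphM/= lecR; apply: le_trans (ler_norm _) _.
rewrite normrM ler_piMr// ger0_norm ?hnorm_ge0//.
by rewrite -lecR -hnormE.
Qed.

(* The library's [contraction] and [is_contraction] ask for a Lipschitz
   constant smaller than one. *)
Definition contractive H K (A : bop H K) := opnorm A <= 1.

Definition isometric H K (A : bop H K) := forall x, `|A x| = `|x|.

(* A Hilbert space H contained in K as a closed linear subspace is given by
   its inclusion map, a linear map H -> K that preserves the inner product;
   the range of such a map is closed, see [inclusion_closed]. *)
Record inclusion H K := Inclusion {
  incl :> {linear H -> K} ;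
  hdot_incl : forall x y, hdot (incl x) (incl y) = hdot x y }.

Lemma norm_incl H K (J : inclusion H K) x : `|J x| = `|x|.
Proof.
by apply/eqP; rewrite -(@eqrXn2 _ 2%N)// -!hdotE hdot_incl.
Qed.

Lemma inclusion_closed H K (J : inclusion H K) : closed (range J).
Proof.
move=> y yJ.
have ex n : exists h, hnorm (y - J h) < n.+1%:R^-1.
  have n0 : 0 < (n.+1%:R^-1 : R)%:C by rewrite ltcR invr_gt0.
  have [_ [[h _ <-]]] := yJ _ (nbhsx_ballx y _ n0).
  by rewrite -ball_normE /ball_/= hnormE ltcR; exists h.
have [u uP] := choice ex.
have inv_small (e : R[i]) : 0 < e -> exists2 r : R, 0 < r & e = r%:C.
  move=> e0; have eE : e = (complex.Re e)%:C by rewrite RRe_real// gtr0_real.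
  by exists (complex.Re e) => //; rewrite -ltcR -eE.
have uJ (r : R) : 0 < r ->
    exists N, forall n, (N <= n)%N -> `|y - J (u n)| < r%:C.
  move=> r0; have [N _ hN] := near_infty_natSinv_lt (PosNum r0).
  exists N => n Nn; rewrite hnormE ltcR.
  exact: lt_trans (uP n) (hN n Nn).
have ucvg : cvg (u @ \oo).
  apply: cauchy_cvg; apply: cauchy_exP => _ /inv_small[r r0 ->].
  have [N hN] := uJ _ (divr_gt0 r0 (ltr0n _ 2)).
  exists (u N), N => // n /= Nn; rewrite -ball_normE /ball_/=.
  rewrite -(norm_incl J) linearB/= -(subrKA y).
  apply: le_lt_trans (ler_normD _ _) _.
  rewrite (splitr r) rmorphD ltrD// ?hN//.
  by rewrite distrC hN.
exists (lim (u @ \oo)) => //; apply/eqP; rewrite -subr_eq0 -normr_le0.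
apply/ler_addgt0Pr => _ /inv_small[r r0 ->]; rewrite add0r.
have r20 : 0 < (r / 2)%:C by rewrite ltcR divr_gt0.
have [N1 _ hN1] := (@cvgrPdist_lt _ _ _ _ _ _ _).1 ucvg _ r20.
have [N2 hN2] := uJ _ (divr_gt0 r0 (ltr0n _ 2)).
set n := maxn N1 N2.
rewrite -(subrKA (J (u n))) -linearB; apply: le_trans (ler_normD _ _) _.
rewrite norm_incl (splitr r) rmorphD lerD// ltW//.
  by apply: hN1; exact: leq_maxl.
by rewrite distrC; apply: hN2; exact: leq_maxr.
Qed.

(* H is invariant under B^* and the restriction of B^* to H is A^*. *)
Definition lift H K (J : inclusion H K) (B : bop K K) (A : bop H H) :=
  forall h, adj B (J h) = J (adj A h).

Definition isometric_lift H K (J : inclusion H K) (B : bop K K) (A : bop H H) :=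
  lift J B A /\ isometric B.

Definition norm_preserving_lift H K (J : inclusion H K)
    (B : bop K K) (A : bop H H) :=
  lift J B A /\ opnorm B = opnorm A.

Definition orthocomp H K (J : inclusion H K) : set K :=
  [set k | forall h, hdot k (J h) = 0].

(* B = A (+) q I with respect to K = H (+) H^perp. *)
Definition dsum_scalar H K (J : inclusion H K)
    (B : bop K K) (A : bop H H) (q : R[i]) :=
  forall h k, orthocomp J k -> B (J h + k) = J (A h) + q *: k.

End operators.

(* Main.v *)
Require Import Defs.
From HB Require Import structures.
From mathcomp Require Import all_boot all_order all_algebra.
From mathcomp Require Import complex ring lra.
From mathcomp Require Import all_classical all_reals all_analysis.

Set Implicit Arguments.
Unset Strict Implicit.
Unset Printing Implicit Defensive.

Import Order.TTheory GRing.Theory Num.Theory.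
Import numFieldNormedType.Exports.

Local Open Scope classical_set_scope.
Local Open Scope ring_scope.
Local Open Scope complex_scope.

(** Fix [q] of modulus one and put [Qb = Q (+) q I] on [K = H (+) H^perp]: it is
an isometric lift of [Q], and all the work goes into [Xt].  Write [B^#] for
the adjoint of [B], and [J] for the inclusion of [H] in [K], whose adjoint is
[coincl].  An operator [B] lifts [A] iff [J^# B = A J^#]; in particular
[J^# V = T J^#] and [J^# Qb = Q J^#].

The equation [V Xt = Qb Xt V] follows from [Xt V = Qb^# V Xt].  Indeed, as [Qb]
is an isometry, only the inclusion of the range of [V Xt] in that of [Qb] is
missing.  The range of [Qb] is [Q H (+) H^perp], and the component of [V Xt k]
in [H] is [J^# V Xt k = T X J^# k = Q X T J^# k], which lies in [Q H].

In terms of [Z = Xt^#] one therefore needs [V^# Z = Z A] with [A = V^# Qb], where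
[Z] extends [X^#] from [H] to [K] without increase of the norm.  On [H] the
equation is the adjoint of [X T = Q^# T X], which follows from [T X = Q X T] as [Q]
is an isometry.  Let [H_n] be the
space of those [k] with [A^n k] in [H].  Because [V] maps [H^perp] into itself
and [Qb] acts there as [q], the orthogonal complement of [H_n] is
[V^n H^perp], so the projection onto [H_n] is [1 - V^n (1 - J J^#) (V^#)^n]; these
increase with [n], and [A] maps [H_(n+1)] into [H_n], and its complement into
that of [H_n].

One passes from [Z] on [H_n] to [Z'] on [H_(n+1)] by [one_step_extension].  The
component of [Z' k] in the range of [V] must be [V Z A k].  The component [D k]
in the kernel of [V^#] is prescribed on [H_n] and must satisfy
[|D k|^2 <= c^2 |k|^2 - |Z A k|^2] with [c] the norm of [X].  The
right-hand side is a nonnegative quadratic form and the bound holds on [H_n], so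
[D] exists by [semi_inner_extension], in which one projects onto [H_n] with
respect to that form.  The successive extensions converge strongly
([strong_limit]): the limit is the extension by continuity to the closure of the
union of the [H_n], and it is zero on the complement, which reduces both [V] and
[A]. *)

(** * Norms and limits in a Hilbert space *)

Section hilbert_facts.
Context {R : realType} {K : hilbertType R}.
Implicit Types (x y z : K) (u : nat -> K) (e : R).

Lemma hnorm2E x : hnorm x ^+ 2 = complex.Re (hdot x x).
Proof. by rewrite hdotE Defs.hnormE -rmorphXn. Qed.

Lemma hnormB x y : hnorm (x - y) = hnorm (y - x).
Proof. by rewrite -[x - y]opprB Defs.hnormN. Qed.

Lemma hnorm_triangle x y : hnorm (x + y) <= hnorm x + hnorm y.
Proof. by rewrite -lecR rmorphD/= -!Defs.hnormE ler_normD. Qed.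

Lemma hnorm_eq0 x : hnorm x = 0 -> x = 0.
Proof. by move=> x0; apply/eqP; rewrite -normr_eq0 Defs.hnormE x0. Qed.

Lemma hnorm0 : hnorm (0 : K) = 0.
Proof. by rewrite /hnorm normr0. Qed.

Lemma hnormZ (a : R[i]) x : hnorm (a *: x) = complex.Re `|a| * hnorm x.
Proof.
apply: (@complexI R); rewrite -Defs.hnormE normrZ Defs.hnormE rmorphM/=.
by congr (_ * _); rewrite normc_def.
Qed.

Lemma invn_small e : 0 < e -> exists N, forall n, (N <= n)%N -> n.+1%:R^-1 < e.
Proof.
by move=> e0; have [N _ hN] := near_infty_natSinv_lt (PosNum e0); exists N => n /hN.
Qed.

Lemma eq0_of_small_hnorm x (c : R) : 0 <= c ->
  (forall e, 0 < e -> hnorm x <= c * e) -> x = 0.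
Proof.
move=> c0 h; apply: hnorm_eq0; apply/eqP; rewrite eq_le hnorm_ge0 andbT.
apply/ler_addgt0Pr => e e0; rewrite add0r.
have c1 : 0 < c + 1 by rewrite ltr_wpDl.
apply: le_trans (h (e / (c + 1)) (divr_gt0 e0 c1)) _.
by rewrite mulrCA ger_pMr// ler_pdivrMr// mul1r lerDl.
Qed.

(** Convergence in norm, with a real error bound in place of the filter over the
ordered field [R[i]]. *)
Definition hlim u x := forall e, 0 < e ->
  exists N, forall n, (N <= n)%N -> hnorm (x - u n) < e.

Lemma hcomplete u :
  (forall e, 0 < e ->
    exists N, forall n, (N <= n)%N -> hnorm (u N - u n) < e) ->
  exists x, hlim u x.
Proof.
move=> cu; have ucvg : cvg (u @ \oo).
  apply: cauchy_cvg; apply: cauchy_exP => /= e e0.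
  have eE : e = (complex.Re e)%:C by rewrite RRe_real// gtr0_real.
  have e0' : 0 < complex.Re e by rewrite -ltcR -eE.
  have [N hN] := cu _ e0'; exists (u N), N => // n /= Nn.
  by rewrite -ball_normE /ball_/= Defs.hnormE eE ltcR hN.
exists (lim (u @ \oo)) => e e0.
have e0' : 0 < e%:C by rewrite ltcR.
have [N _ hN] := (@cvgrPdist_lt _ _ _ _ _ _ _).1 ucvg _ e0'.
by exists N => n Nn; have := hN n Nn; rewrite /= Defs.hnormE ltcR.
Qed.

End hilbert_facts.

(** * Extension of a map bounded by a nonnegative form *)

Section semi_inner.
Context {R : realType} {E F : lmodType R[i]} {K : hilbertType R}.
(** [b] may be degenerate and [E] is not complete, so the projection onto the
range of [f] is only reached approximately. *)
Variables (b : E -> E -> R[i]) (f : {linear F -> E}) (g : {linear F -> K}).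
Hypothesis b_linl : forall (a : R[i]) x y z, b (a *: x + y) z = a * b x z + b y z.
Hypothesis b_herm : forall x y, b y x = (b x y)^*.
Hypothesis b_ge0 : forall x, 0 <= complex.Re (b x x).
Let q x := complex.Re (b x x).
Hypothesis g_le : forall x, hnorm (g x) ^+ 2 <= q (f x).

Let p x := Num.sqrt (q x).
Let p_ge0 x : 0 <= p x. Proof. exact: sqrtr_ge0. Qed.
Let p2 x : p x ^+ 2 = q x. Proof. by rewrite sqr_sqrtr// b_ge0. Qed.
Let r x y := complex.Re (b x y).

Let ReD (z w : R[i]) : complex.Re (z + w) = complex.Re z + complex.Re w.
Proof. by case: z; case: w. Qed.

Let rDl x y z : r (x + y) z = r x z + r y z.
Proof. by rewrite /r -[x]scale1r b_linl mul1r ReD scale1r. Qed.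

Let rC x y : r y x = r x y.
Proof. by rewrite /r b_herm; case: (b x y). Qed.

Let b0l z : b 0 z = 0.
Proof.
by apply: (addrI (b 0 z)); have := b_linl 1 0 0 z; rewrite scale1r mul1r !addr0.
Qed.

Let bZl a x z : b (a *: x) z = a * b x z.
Proof. by rewrite -[a *: x]addr0 b_linl b0l addr0. Qed.

Let rZl (t : R) x z : r (t%:C *: x) z = t * r x z.
Proof. by rewrite /r bZl; case: (b x z) => c d /=; rewrite mul0r subr0. Qed.

Let rZlr a x z : r (a *: x) z = r x (a^* *: z).
Proof.
rewrite /r bZl [b x (_ *: _)]b_herm bZl rmorphM/= conjcK.
by rewrite (b_herm z x).
Qed.

Let rNl x z : r (- x) z = - r x z.
Proof. by rewrite -scaleN1r /r bZl mulN1r; case: (b x z). Qed.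

Let rBl x y z : r (x - y) z = r x z - r y z.
Proof. by rewrite rDl rNl. Qed.

Let pZ a x : p (a *: x) = complex.Re `|a| * p x.
Proof.
rewrite /p; have -> : q (a *: x) = (complex.Re `|a|) ^+ 2 * q x.
  rewrite /q -/(r _ _) rZlr /r b_herm !bZl; case: a => c d.
  rewrite normc_def/= sqr_sqrtr ?addr_ge0 ?sqr_ge0//.
  by case: (b x x) => s t /=; ring.
rewrite sqrtrM ?sqr_ge0// sqrtr_sqr ger0_norm//.
by rewrite normc_def/= sqrtr_ge0.
Qed.

(** If [u] is within [e ^+ 2] of the least value of [q] on the line through [u]
in direction [v], then [u] is nearly orthogonal to [v]; comparing the linear with
the quadratic term in [t] gives the bound. *)
Let variation u v e : 0 <= e ->
  (forall t : R, q u - e ^+ 2 <= q (u - t%:C *: v)) -> r u v <= e * p v.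
Proof.
move=> e0 h.
have {}h t : 2 * t * r u v <= e ^+ 2 + t ^+ 2 * p v ^+ 2.
  have := h t; rewrite -p2 -p2 p2 [p _ ^+ 2]p2.
  have -> : q (u - t%:C *: v) = q u - 2 * t * r u v + t ^+ 2 * q v.
    rewrite /q -!/(r _ _) rBl ![r _ (u - _)]rC !rBl.
    rewrite !rZl [r u (_ *: _)]rC [r v (_ *: _)]rC !rZl [r v u]rC; ring.
  rewrite p2; lra.
have := p_ge0 v; rewrite le_eqVlt => /predU1P[pv0|pv].
  (* For [q v = 0] the bound is linear in [t]; this [t] violates it. *)
  rewrite -pv0 mulr0 leNgt; apply/negP => r0.
  have := h ((e ^+ 2 + 1) / r u v).
  rewrite -pv0 expr0n/= mulr0 addr0 -mulrA divfK ?gt_eqF//.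
  by have := sqr_ge0 e; lra.
have := e0; rewrite le_eqVlt => /predU1P[e0'|e0'].
  (* This [t] minimizes [q (u - t v)]. *)
  rewrite -e0' mul0r leNgt; apply/negP => r0.
  have := h (r u v / p v ^+ 2).
  have -> : 2 * (r u v / p v ^+ 2) * r u v = 2 * (r u v / p v) ^+ 2.
    by field; rewrite gt_eqF.
  have -> : (r u v / p v ^+ 2) ^+ 2 * p v ^+ 2 = (r u v / p v) ^+ 2.
    by field; rewrite gt_eqF.
  have : 0 < (r u v / p v) ^+ 2 by rewrite exprn_gt0// divr_gt0.
  by rewrite -e0' expr0n/=; lra.
(* This [t] makes the two terms on the right equal. *)
have := h (e / p v).
have -> : (e / p v) ^+ 2 * p v ^+ 2 = e ^+ 2 by field; rewrite gt_eqF.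
have -> : 2 * (e / p v) * r u v = 2 * (e * (r u v / p v)) by field; rewrite gt_eqF.
move=> h1; have : e * (r u v / p v) <= e * e by move: h1; rewrite !expr2; lra.
by rewrite ler_pM2l// ler_pdivrMr.
Qed.

(** Cauchy-Schwarz is the trivial case of [variation]: [q] is nonnegative, so any
[u] is within [q u] of the least value. *)
Let CS u v : r u v <= p u * p v.
Proof. by apply: variation => // t; rewrite p2 subrr b_ge0. Qed.

(** [f x] is, up to [e], the projection of [k] onto the range of [f].  Stated by
orthogonality rather than by minimality this is visibly linear in [(k, x)].  The
real part suffices because [y] may be multiplied by complex scalars. *)
Let near_proj k x e := forall y, r (k - f x) (f y) <= e * p (f y).

Let near_proj_ex k e : 0 < e -> exists x, near_proj k x e.
Proof.
move=> e0; pose S := range (fun x => q (k - f x)).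
have hS : has_inf S.
  by split; [exists (q (k - f 0)), 0 | exists 0 => _ [x _ <-]; exact: b_ge0].
have [_ [x _ <-] hx] := inf_adherent (exprn_gt0 2 e0) hS.
exists x => y; apply: variation; first exact: ltW.
move=> t; rewrite lerBlDr; apply: le_trans (ltW hx) _; rewrite lerD2r.
apply: ge_inf; first exact: hS.2.
by exists (x + t%:C *: y) => //; rewrite linearD linearZ/= opprD addrA.
Qed.

(** This is what makes [g x] converge as [e] tends to [0], although [f x] need
not have a limit. *)
Let near_proj_dist k x x' e e' : 0 <= e -> 0 <= e' ->
  near_proj k x e -> near_proj k x' e' ->
  hnorm (g x - g x') <= e + e'.
Proof.
move=> e0 e0' h h'; rewrite -linearB; set w := x - x'.
have pw : hnorm (g w) <= p (f w).
  by rewrite -(@ler_pXn2r _ 2%N) ?nnegrE ?hnorm_ge0// p2.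
apply: le_trans pw _.
have pN : p (f (- w)) = p (f w) by rewrite linearN -scaleN1r pZ normrN1 mul1r.
have : p (f w) * p (f w) <= (e + e') * p (f w).
  have -> : p (f w) * p (f w) = r (k - f x') (f w) + r (k - f x) (f (- w)).
    rewrite -expr2 p2 linearN [r _ (- _)]rC rNl [r (f w) _]rC -rBl.
    by rewrite opprB addrC addrA subrK -linearB.
  by rewrite mulrDl addrC -{1}pN lerD.
have := p_ge0 (f w); rewrite le_eqVlt => /predU1P[<- _|pw0]; last first.
  by rewrite ler_pM2r.
by rewrite addr_ge0.
Qed.

Let near_proj_lin a k k' x x' e e' : near_proj k x e -> near_proj k' x' e' ->
  near_proj (a *: k + k') (a *: x + x') (complex.Re `|a| * e + e').
Proof.
move=> h h' y; rewrite linearP opprD addrACA -scalerN -scalerDr rDl rZlr -linearZ.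
rewrite mulrDl lerD//; apply: le_trans (h _) _.
by rewrite linearZ/= pZ norm_conjC mulrA [e * _]mulrC.
Qed.

Let near_proj_le k x e : 0 <= e -> near_proj k x e -> hnorm (g x) <= p k + e.
Proof.
move=> e0 h.
have pN : p (f (- x)) = p (f x) by rewrite linearN -scaleN1r pZ normrN1 mul1r.
have pg : hnorm (g x) <= p (f x).
  by rewrite -(@ler_pXn2r _ 2%N) ?nnegrE ?hnorm_ge0// p2.
apply: le_trans pg _.
have : p (f x) * p (f x) <= (p k + e) * p (f x).
  have -> : p (f x) * p (f x) = r k (f x) + r (k - f x) (f (- x)).
    by rewrite -expr2 p2 linearN [r _ (- _)]rC rNl [r (f x) _]rC rBl opprB subrKC.
  by rewrite mulrDl -{2}pN lerD.
have := p_ge0 (f x); rewrite le_eqVlt => /predU1P[<- _|px0]; last first.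
  by rewrite ler_pM2r.
by rewrite addr_ge0.
Qed.

(** [d] is the value at [k] of [g] extended by continuity and composed with the
projection onto the range of [f]. *)
Let rel k d := forall e, 0 < e -> exists2 x, near_proj k x e & hnorm (d - g x) <= e.

Let rel_ex k : exists d, rel k d.
Proof.
have inv0 n : 0 < n.+1%:R^-1 :> R by rewrite invr_gt0.
have [x hx] := choice (fun n => near_proj_ex k (inv0 n)).
have xcauchy e : 0 < e ->
    exists N, forall n, (N <= n)%N -> hnorm (g (x N) - g (x n)) < e.
  move=> e0; have [N hN] := invn_small (divr_gt0 e0 (ltr0n _ 2)).
  exists N => n Nn.
  apply: le_lt_trans (near_proj_dist (ltW (inv0 _)) (ltW (inv0 _)) (hx N) (hx n)) _.
  by rewrite (splitr e) ltrD// hN.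
have [d hd] := hcomplete xcauchy; exists d => e e0.
have [N1 hN1] := hd _ e0; have [N2 hN2] := invn_small e0.
exists (x (maxn N1 N2)); last by apply/ltW/hN1/leq_maxl.
move=> y; apply: le_trans (hx _ _) _.
by rewrite ler_wpM2r// ltW// hN2// leq_maxr.
Qed.

Let rel_uniq k d d' : rel k d -> rel k d' -> d = d'.
Proof.
move=> h h'; apply/eqP; rewrite -subr_eq0; apply/eqP.
apply: (@eq0_of_small_hnorm _ _ _ 4) => // e e0.
have [x hx dx] := h _ e0; have [x' hx' dx'] := h' _ e0.
have := near_proj_dist (ltW e0) (ltW e0) hx hx'.
have -> : d - d' = (d - g x) + ((g x - g x') + (g x' - d')).
  by rewrite subrKA subrKA.
have := hnorm_triangle (d - g x) ((g x - g x') + (g x' - d')).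
have := hnorm_triangle (g x - g x') (g x' - d').
rewrite (hnormB _ d'); lra.
Qed.

Let rel_lin a k k' d d' : rel k d -> rel k' d' -> rel (a *: k + k') (a *: d + d').
Proof.
move=> h h' e e0.
have [c ca c0] : exists2 c, complex.Re `|a| = c & 0 <= c.
  by exists (complex.Re `|a|) => //; rewrite normc_def/= sqrtr_ge0.
have c1 : 0 < c + 1 by rewrite ltr_wpDl.
have e1 : 0 < e / (c + 1) by rewrite divr_gt0.
have eE : e = c * (e / (c + 1)) + e / (c + 1) by field; rewrite gt_eqF.
have [x hx dx] := h _ e1; have [x' hx' dx'] := h' _ e1.
exists (a *: x + x'); rewrite eE -{1}ca; first exact: near_proj_lin.
rewrite linearP opprD addrACA -scalerN -scalerDr.
apply: le_trans (hnorm_triangle _ _) _.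
by rewrite hnormZ ca lerD// ler_wpM2l.
Qed.

(** A Hahn-Banach theorem with values in a Hilbert space.  It holds because the
seminorm comes from a form: the extension is [g] after the orthogonal projection
onto the range of [f], which does not increase the seminorm. *)
Lemma semi_inner_extension : exists D : {linear E -> K},
  (forall x, D (f x) = g x) /\
  (forall k, hnorm (D k) ^+ 2 <= complex.Re (b k k)).
Proof.
have [D hD] := choice rel_ex.
have Dlin : linear D.
  by move=> a k k'; apply: (@rel_uniq (a *: k + k')); [|apply: rel_lin]; exact: hD.
pose DL : {linear E -> K} := HB.pack D (GRing.isLinear.Build _ _ _ _ _ Dlin).
exists DL; split=> [x|k].
  apply: (@rel_uniq (f x)) => [|e e0]; first exact: hD.
  exists x.
    by move=> y; rewrite subrr /r b0l mulr_ge0// ltW.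
  by rewrite subrr hnorm0 ltW.
rewrite -/(q k) -p2 ler_pXn2r ?nnegrE ?hnorm_ge0//=.
apply/ler_addgt0Pr => e e0.
have [x hx dx] := hD k _ (divr_gt0 e0 (ltr0n _ 2)).
have := near_proj_le (ltW (divr_gt0 e0 (ltr0n _ 2))) hx.
have := hnorm_triangle (D k - g x) (g x); rewrite subrK; lra.
Qed.

End semi_inner.

(** * Limits, isometries and adjoints *)

Section limits_and_adjoints.
Context {R : realType}.
Implicit Types H K : hilbertType R.

Lemma hlim_uniq K (u : nat -> K) x y : hlim u x -> hlim u y -> x = y.
Proof.
move=> ux uy; apply/eqP; rewrite -subr_eq0; apply/eqP.
apply: (@eq0_of_small_hnorm _ _ _ 2) => // e e0.
have [N1 h1] := ux _ e0; have [N2 h2] := uy _ e0.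
have := h1 _ (leq_maxl N1 N2); have := h2 _ (leq_maxr N1 N2).
move: (u _) => v; rewrite (hnormB y).
have := hnorm_triangle (x - v) (v - y); rewrite subrKA; lra.
Qed.

Lemma hlim_shift K (u : nat -> K) x : hlim u x -> hlim (fun n => u n.+1) x.
Proof.
by move=> ux e /ux[N hN]; exists N => n Nn; apply: hN; exact: leqW.
Qed.

Lemma hlim_contractive H K (f : {linear H -> K}) u x :
  (forall y, hnorm (f y) <= hnorm y) -> hlim u x -> hlim (fun n => f (u n)) (f x).
Proof.
move=> fle ux e /ux[N hN]; exists N => n Nn.
by rewrite -linearB; apply: le_lt_trans (fle _) (hN n Nn).
Qed.

Lemma hlim_lin K (u v : nat -> K) (a : R[i]) x y : hlim u x -> hlim v y ->
  hlim (fun n => a *: u n + v n) (a *: x + y).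
Proof.
move=> ux vy e e0.
have [c ca c0] : exists2 c, complex.Re `|a| = c & 0 <= c.
  by exists (complex.Re `|a|) => //; rewrite normc_def/= sqrtr_ge0.
have c1 : 0 < c + 1 by rewrite ltr_wpDl.
have e1 : 0 < e / (c + 1) by rewrite divr_gt0.
have eE : e = c * (e / (c + 1)) + e / (c + 1) by field; rewrite gt_eqF.
have [N1 h1] := ux _ e1; have [N2 h2] := vy _ e1.
exists (maxn N1 N2) => n; rewrite geq_max => /andP[n1 n2].
rewrite opprD addrACA -scalerN -scalerDr.
apply: le_lt_trans (hnorm_triangle _ _) _.
rewrite eE hnormZ ca ler_ltD ?h2//.
by rewrite ler_wpM2l// ltW// h1.
Qed.

Lemma hlim_le K (u : nat -> K) x (M : R) :
  (forall n, hnorm (u n) <= M) -> hlim u x -> hnorm x <= M.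
Proof.
move=> uM ux; apply/ler_addgt0Pr => e e0; have [N hN] := ux _ e0.
have := hN _ (leqnn N); have := uM N; have := hnorm_triangle (x - u N) (u N).
rewrite subrK; lra.
Qed.

Lemma hdot_adjl H K (B : bop H K) x y : hdot (adj B x) y = hdot x (B y).
Proof. by rewrite hdotC -adjP -hdotC. Qed.

Lemma isometric_hnorm H K (B : bop H K) x : isometric B -> hnorm (B x) = hnorm x.
Proof. by rewrite /hnorm => ->. Qed.

Lemma hnorm_adj_le H K (B : bop H K) (c : R) y : 0 <= c ->
  (forall x, hnorm (B x) <= c * hnorm x) -> hnorm (adj B y) <= c * hnorm y.
Proof.
move=> c0 Bc; have := hnorm_ge0 (adj B y).
rewrite le_eqVlt => /predU1P[<-|y0]; first by rewrite mulr_ge0 ?hnorm_ge0.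
rewrite -(ler_pM2l y0) -expr2 hnorm2E hdot_adjl.
apply: le_trans (ler_norm _) _; apply: le_trans (Re_hdot_le _ _) _.
have -> : hnorm (adj B y) * (c * hnorm y) = hnorm y * (c * hnorm (adj B y)) by ring.
by rewrite ler_wpM2l ?hnorm_ge0.
Qed.

Lemma hnorm_adj_isometric H K (B : bop H K) y :
  isometric B -> hnorm (adj B y) <= hnorm y.
Proof.
move=> Bi; rewrite -[leRHS]mul1r; apply: hnorm_adj_le => // x.
by rewrite isometric_hnorm// mul1r.
Qed.

Lemma isometric_adjK H K (B : bop H K) x : isometric B -> adj B (B x) = x.
Proof.
move=> Bi; apply/eqP; rewrite -subr_eq0; apply/eqP/hnorm_eq0/eqP.
rewrite -[_ == 0](expf_eq0 _ 2) eq_le sqr_ge0 andbT.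
rewrite hnorm_sqrD Defs.hnormN hdotNr hdot_adjl.
have -> : complex.Re (- hdot (B x) (B x)) = - hnorm x ^+ 2.
  by rewrite -(isometric_hnorm x Bi) hnorm2E; case: (hdot _ _).
have : hnorm (adj B (B x)) ^+ 2 <= hnorm x ^+ 2.
  rewrite ler_pXn2r ?nnegrE ?hnorm_ge0//.
  by rewrite -(isometric_hnorm x Bi) hnorm_adj_isometric.
lra.
Qed.

(** * One step of the extension *)

Section step.
Context {K : hilbertType R}.
Variables (V : bop K K) (A P P' Z : {linear K -> K}) (c : R).
Hypothesis V_isom : isometric V.
Hypothesis A_le : forall k, hnorm (A k) <= hnorm k.
Hypothesis P'P : forall k, P' (P k) = P k.
Hypothesis PA : forall k, P (A k) = A (P' k).
Hypothesis c_ge0 : 0 <= c.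
Hypothesis Z_le : forall k, hnorm (Z k) <= c * hnorm (P k).
Hypothesis VZ : forall k, adj V (Z k) = Z (A (P k)).

(** Think of [P] and [P'] as the projections onto [M] and [M'] with [M] inside
[M'], and of [Z], [Z'] as defined there.  The equation
[adj V (Z' k) = Z (A k)] determines the component of [Z' k] in the range of [V].
The orthogonal component is free as long as it agrees with that of [Z k] for [k]
in [M]; the norm bound leaves it the room
[c ^+ 2 |P' k| ^+ 2 - |Z (A k)| ^+ 2], which for [k] in [M] is sufficient by
Pythagoras and [VZ]. *)
Lemma one_step_extension : exists Z' : {linear K -> K},
  [/\ forall k, hnorm (Z' k) <= c * hnorm (P' k),
      forall k, Z' (P k) = Z k &
      forall k, adj V (Z' k) = Z (A k)].
Proof.
have ReB (z w : R[i]) : complex.Re (z - w) = complex.Re z - complex.Re w.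
  by case: z; case: w.
have ReZ (t : R) z : complex.Re (t%:C * z) = t * complex.Re z.
  by case: z => a d /=; rewrite mul0r subr0.
pose b x y := (c ^+ 2)%:C * hdot (P' x) (P' y) - hdot (Z (A x)) (Z (A y)).
have bE k : complex.Re (b k k) = (c * hnorm (P' k)) ^+ 2 - hnorm (Z (A k)) ^+ 2.
  by rewrite ReB ReZ -!hnorm2E exprMn.
have b_linl a x y z : b (a *: x + y) z = a * b x z + b y z.
  by rewrite /b !linearP !hdotPl; ring.
have b_herm x y : b y x = (b x y)^*.
  rewrite /b (hdotC (P' x)) (hdotC (Z (A x))) rmorphB.
  congr (_ - _); apply/esym; rewrite [LHS]rmorphM; congr (_ * _).
  exact: conjc_real.
have b_ge0 x : 0 <= complex.Re (b x x).
  rewrite bE subr_ge0 ler_pXn2r ?nnegrE ?mulr_ge0 ?hnorm_ge0//.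
  by apply: le_trans (Z_le _) _; rewrite ler_wpM2l// PA.
pose E k := Z k - V (adj V (Z k)).
have E_lin : linear E.
  by move=> a x y; rewrite /E !linearP/= addrACA -scalerDr.
pose EL : {linear K -> K} := HB.pack E (GRing.isLinear.Build _ _ _ _ _ E_lin).
have ker y : adj V (y - V (adj V y)) = 0.
  by rewrite linearB/= isometric_adjK// subrr.
(* Pythagoras: [y - V (adj V y)] is orthogonal to the range of [V]. *)
have pyth y z : hnorm (V z + (y - V (adj V y))) ^+ 2 =
    hnorm z ^+ 2 + hnorm (y - V (adj V y)) ^+ 2.
  rewrite hnorm_sqrD isometric_hnorm// hdotBr !adjP.
  by rewrite isometric_adjK// subrr mulr0 addr0.
have E_le k : hnorm (EL k) ^+ 2 <= complex.Re (b (P k) (P k)).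
  rewrite bE P'P -VZ lerBrDl -pyth subrKC.
  by rewrite ler_pXn2r ?nnegrE ?mulr_ge0 ?hnorm_ge0.
have [D [DP D_le]] := semi_inner_extension b_linl b_herm b_ge0 E_le.
(* [D] may leave the kernel of [adj V], hence is projected onto it. *)
pose Z' k := V (Z (A k)) + (D k - V (adj V (D k))).
have Z'_lin : linear Z'.
  move=> a x y.
  by rewrite /Z' !linearP/= (addrACA (a *: D x)) (addrACA (a *: V _)) -!scalerDr.
pose Z'L : {linear K -> K} := HB.pack Z' (GRing.isLinear.Build _ _ _ _ _ Z'_lin).
exists Z'L.
split=> /= k; rewrite /Z'.
- rewrite -(@ler_pXn2r _ 2%N) ?nnegrE ?mulr_ge0 ?hnorm_ge0// pyth.
  rewrite addrC -lerBrDr -bE; apply: le_trans (D_le k).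
  rewrite ler_pXn2r ?nnegrE ?hnorm_ge0//.
  rewrite -(@ler_pXn2r _ 2%N) ?nnegrE ?hnorm_ge0//.
  have := pyth (D k) (adj V (D k)); rewrite subrKC => ->.
  by rewrite lerDr sqr_ge0.
- by rewrite DP/= ker -VZ linear0 subr0 subrKC.
- by rewrite linearD/= ker isometric_adjK// addr0.
Qed.

End step.

(** * Passage to the limit *)

Section limit.
Context {K L : hilbertType R}.
Variables (P : nat -> K -> K) (Z : nat -> {linear K -> L}) (c : R).
Hypothesis P_sym : forall n x y, hdot (P n x) y = hdot x (P n y).
Hypothesis P_idem : forall n x, P n (P n x) = P n x.
Hypothesis P_incr : forall n x, P n.+1 (P n x) = P n x.
Hypothesis c_ge0 : 0 <= c.
Hypothesis Z_le : forall n x, hnorm (Z n x) <= c * hnorm (P n x).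
Hypothesis Z_ext : forall n x, Z n.+1 (P n x) = Z n x.

(** The [P n k] form a Cauchy sequence, as the images of [k] under increasing
projections: their norms increase and are bounded by that of [k].  Moreover, [Z m k - Z n k = Z m (P m k - P n k)] for [n <= m]. *)
Lemma strong_limit : exists Zi : {linear K -> L},
  (forall k, hnorm (Zi k) <= c * hnorm k) /\
  (forall k, hlim (fun n => Z n k) (Zi k)).
Proof.
have PPle n m x : (n <= m)%N -> P m (P n x) = P n x.
  elim: m => [|m IH]; first by rewrite leqn0 => /eqP ->.
  rewrite leq_eqVlt => /predU1P[->|/IH nm]; first by rewrite P_idem.
  by rewrite -[in LHS]nm P_incr nm.
have P_hdot n m k : (n <= m)%N -> hdot (P m k) (P n k) = hdot (P n k) (P n k).
  by move=> nm; rewrite !P_sym PPle ?P_idem.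
have P_diff n m k : (n <= m)%N ->
    hnorm (P m k - P n k) ^+ 2 = hnorm (P m k) ^+ 2 - hnorm (P n k) ^+ 2.
  move=> nm; rewrite hnorm_sqrD Defs.hnormN hdotNr P_hdot// (hnorm2E (P n k)).
  by case: (hdot (P n k) (P n k)) => a d /=; ring.
have PB n x y : P n (x - y) = P n x - P n y.
  by apply: hdot_injr => w; rewrite -P_sym !hdotBr -!P_sym.
have P_le n k : hnorm (P n k) <= hnorm k.
  rewrite -(@ler_pXn2r _ 2%N) ?nnegrE ?hnorm_ge0//.
  have := sqr_ge0 (hnorm (k - P n k)); rewrite hnorm_sqrD Defs.hnormN hdotNr.
  rewrite -[in hdot k _]P_idem -P_sym (hnorm2E (P n k)).
  case: (hdot (P n k) _) => a d /=; lra.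
have ZP n k : Z n (P n k) = Z n k.
  apply/eqP; rewrite -subr_eq0 -linearB; apply/eqP/hnorm_eq0/eqP.
  rewrite eq_le hnorm_ge0 andbT; apply: le_trans (Z_le _ _) _.
  by rewrite PB P_idem subrr hnorm0 mulr0.
have ZZ n m k : (n <= m)%N -> Z m (P n k) = Z n k.
  elim: m => [|m IH]; first by rewrite leqn0 => /eqP ->; rewrite ZP.
  rewrite leq_eqVlt => /predU1P[->|nm]; first by rewrite ZP.
  by rewrite -(PPle n m)// Z_ext IH.
have Zcauchy k e : 0 < e ->
    exists N, forall n, (N <= n)%N -> hnorm (Z N k - Z n k) < e.
  move=> e0; have c1 : 0 < c ^+ 2 + 1 by rewrite ltr_wpDl// sqr_ge0.
  have d0 : 0 < e ^+ 2 / (c ^+ 2 + 1) by rewrite divr_gt0// exprn_gt0.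
  have hS : has_sup (range (fun n => hnorm (P n k) ^+ 2)).
    split; first by exists (hnorm (P 0%N k) ^+ 2), 0%N.
    exists (hnorm k ^+ 2) => _ [n _ <-].
    by rewrite ler_pXn2r ?nnegrE ?hnorm_ge0.
  have [_ [N _ <-] hN] := sup_adherent d0 hS.
  exists N => n Nn.
  have {}hN : hnorm (P n k - P N k) ^+ 2 < e ^+ 2 / (c ^+ 2 + 1).
    rewrite P_diff// ltrBlDl -ltrBlDr; apply: le_lt_trans hN.
    by rewrite lerD2r; apply: sup_ubound; [exact: hS.2|exists n].
  rewrite -(ZZ N n)// -linearB.
  apply: le_lt_trans (Z_le _ _) _; rewrite PB PPle// hnormB.
  rewrite -(@ltr_pXn2r _ 2%N) ?nnegrE ?mulr_ge0 ?hnorm_ge0 ?(ltW e0)// exprMn.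
  have -> : e ^+ 2 = (c ^+ 2 + 1) * (e ^+ 2 / (c ^+ 2 + 1)).
    by field; rewrite gt_eqF.
  rewrite mulrDl mul1r; apply: (@le_lt_trans _ _ (c ^+ 2 * (e ^+ 2 / (c ^+ 2 + 1)))).
    by rewrite ler_wpM2l ?sqr_ge0// ltW.
  by rewrite ltrDl.
have [Zi hZi] := choice (fun k => hcomplete (Zcauchy k)).
have Zi_lin : linear Zi.
  move=> a x y; apply: hlim_uniq (hZi _) _.
  have -> : (fun n => Z n (a *: x + y)) = (fun n => a *: Z n x + Z n y).
    by apply/funext => n; rewrite linearP.
  exact: hlim_lin.
pose ZiL : {linear K -> L} := HB.pack Zi (GRing.isLinear.Build _ _ _ _ _ Zi_lin).
exists ZiL; split=> // k.
apply: hlim_le (hZi k) => n; apply: le_trans (Z_le _ _) _.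
by rewrite ler_wpM2l.
Qed.
End limit.
End limits_and_adjoints.

Section intertwiner.
Context {R : realType} {K : hilbertType R}.
Variables (V : bop K K) (A Z0 : {linear K -> K}) (P : nat -> {linear K -> K}) (c : R).
Hypothesis V_isom : isometric V.
Hypothesis A_le : forall k, hnorm (A k) <= hnorm k.
Hypothesis P_sym : forall n x y, hdot (P n x) y = hdot x (P n y).
Hypothesis P_idem : forall n x, P n (P n x) = P n x.
Hypothesis P_incr : forall n x, P n.+1 (P n x) = P n x.
Hypothesis PA : forall n k, P n (A k) = A (P n.+1 k).
Hypothesis c_ge0 : 0 <= c.
Hypothesis Z0_le : forall k, hnorm (Z0 k) <= c * hnorm (P 0 k).
Hypothesis VZ0 : forall k, adj V (Z0 k) = Z0 (A (P 0 k)).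

(** The hypothesis on [P] and [A] says that [A] maps the range of [P n.+1] into
that of [P n], and the kernel into the kernel. *)
Theorem intertwiner_extension : exists Z : {linear K -> K},
  [/\ forall k, hnorm (Z k) <= c * hnorm k,
      forall k, Z (P 0 k) = Z0 k &
      forall k, adj V (Z k) = Z (A k)].
Proof.
pose good n (Z : {linear K -> K}) :=
  (forall k, hnorm (Z k) <= c * hnorm (P n k)) /\
  (forall k, adj V (Z k) = Z (A (P n k))).
have next n Z : {Z' : {linear K -> K} | good n Z ->
    [/\ good n.+1 Z', forall k, Z' (P n k) = Z k &
        forall k, adj V (Z' k) = Z (A k)]}.
  apply: cid; have [[Zle VZ]|bad] := pselect (good n Z); last by exists Z.
  have [Z' [Z'le Z'P VZ']] := one_step_extension V_isom A_le (P_incr n)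
    (PA n) c_ge0 Zle VZ.
  exists Z' => _; split=> //; split=> // k.
  by rewrite VZ' -PA Z'P.
pose Zs := nat_rect (fun _ => {linear K -> K}) Z0 (fun n Z => projT1 (next n Z)).
have Zs_good n : good n (Zs n).
  elim: n => [|n IH]; first by split.
  by have [] := projT2 (next n (Zs n)) IH.
have ZsP n k : Zs n.+1 (P n k) = Zs n k.
  by have [_ + _] := projT2 (next n (Zs n)) (Zs_good n); exact.
have VZs n k : adj V (Zs n.+1 k) = Zs n (A k).
  by have [_ _ +] := projT2 (next n (Zs n)) (Zs_good n); exact.
have Zs_le n k : hnorm (Zs n k) <= c * hnorm (P n k) by case: (Zs_good n).
have [Z [Z_le Z_lim]] := strong_limit P_sym P_idem P_incr c_ge0 Zs_le ZsP.
exists Z; split=> // k.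
  apply: hlim_uniq (Z_lim _) _ => e e0; exists 0%N => n _.
  suff -> : Zs n (P 0%N k) = Z0 k by rewrite subrr hnorm0.
  have PP m : P m (P 0%N k) = P 0%N k.
    by elim: m => [|m IH]; [exact: P_idem|rewrite -[in LHS]IH P_incr IH].
  elim: n => [|n IH]; last by rewrite -(PP n) ZsP.
  apply/eqP; rewrite -subr_eq0 -linearB; apply/eqP/hnorm_eq0/eqP.
  rewrite eq_le hnorm_ge0 andbT; apply: le_trans (Z0_le _) _.
  by rewrite linearB/= P_idem subrr hnorm0 mulr0.
have h1 := hlim_contractive (fun y => hnorm_adj_isometric y V_isom)
  (hlim_shift (Z_lim k)).
have h2 := Z_lim (A k).
apply: hlim_uniq h1 _ => e /h2[N hN]; exists N => n Nn.
by rewrite VZs hN.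
Qed.

End intertwiner.

(** * Operators and lifts *)

Section operators_and_lifts.
Context {R : realType}.
Implicit Types H K : hilbertType R.

Lemma bop_of_bounded H K (f : {linear H -> K}) (c : R) :
  (forall x, hnorm (f x) <= c * hnorm x) -> exists B : bop H K, B =1 f.
Proof.
move=> fle; have fb : exists M : R, forall x, `|f x| <= M%:C * `|x|.
  by exists c => x; rewrite !Defs.hnormE -rmorphM lecR.
by exists (Bop fb).
Qed.

Lemma hnorm_opnorm H K (B : bop H K) x : hnorm (B x) <= opnorm B * hnorm x.
Proof.
have [->|x0] := eqVneq x 0; first by rewrite linear0 !hnorm0 mulr0.
have nx : 0 < hnorm x.
  by rewrite lt_neqAle hnorm_ge0 andbT eq_sym; apply: contra_neq x0; exact: hnorm_eq0.
rewrite -ler_pdivrMr//.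
have -> : hnorm (B x) / hnorm x = hnorm (B ((hnorm x)^-1%:C *: x)).
  by rewrite linearZ hnormZr ger0_norm ?invr_ge0 ?hnorm_ge0// mulrC.
apply: sup_ubound; first exact: (opnorm_has_sup B).2.
exists ((hnorm x)^-1%:C *: x) => //=.
rewrite Defs.hnormE hnormZr ger0_norm ?invr_ge0 ?hnorm_ge0//.
by rewrite mulVf ?gt_eqF.
Qed.

Lemma opnorm_ge0 H K (B : bop H K) : 0 <= opnorm B.
Proof.
apply: le_trans (hnorm_ge0 (B 0)) _.
apply: sup_ubound; first exact: (opnorm_has_sup B).2.
by exists 0 => //=; rewrite normr0.
Qed.

Lemma opnorm_le H K (B : bop H K) (c : R) : 0 <= c ->
  (forall x, hnorm (B x) <= c * hnorm x) -> opnorm B <= c.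
Proof.
move=> c0 Bc; apply: ge_sup; first exact: (opnorm_has_sup B).1.
move=> _ [x /= x1 <-]; apply: le_trans (Bc x) _.
by rewrite ler_piMr// -lecR -Defs.hnormE.
Qed.

Lemma adjK H K (B : bop H K) x : adj (adj B) x = B x.
Proof. by apply: hdot_injr => w; rewrite -adjP hdot_adjl. Qed.

Section incl.
Variables (H K : hilbertType R) (J : inclusion H K).

Lemma incl_bounded : exists M : R, forall x, `|J x| <= M%:C * `|x|.
Proof. by exists 1 => x; rewrite norm_incl mul1r. Qed.

Definition coincl : bop K H := adj (Bop incl_bounded).

Lemma hdot_incll h k : hdot (J h) k = hdot h (coincl k).
Proof. exact: (adjP (Bop incl_bounded)). Qed.

Lemma hdot_inclr h k : hdot k (J h) = hdot (coincl k) h.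
Proof. by rewrite hdotC hdot_incll -hdotC. Qed.

Lemma inclK h : coincl (J h) = h.
Proof. by apply: hdot_injr => w; rewrite -hdot_incll hdot_incl. Qed.

Lemma hnorm_incl h : hnorm (J h) = hnorm h.
Proof. by rewrite /hnorm norm_incl. Qed.

Lemma hnorm_coincl k : hnorm (coincl k) <= hnorm k.
Proof.
rewrite -[leRHS]mul1r; apply: hnorm_adj_le => // h.
by rewrite mul1r hnorm_incl.
Qed.

(** Dual form of lifting: with respect to [K = H (+) H^perp] the operator [B] is
lower triangular with [A] in the upper left corner. *)
Lemma lift_coincl (B : bop K K) (A : bop H H) :
  Defs.lift J B A <-> forall k, coincl (B k) = A (coincl k).
Proof.
split=> [BA k|BA h].
  by apply: hdot_injr => w; rewrite -hdot_incll -hdot_adjl BA hdot_incll hdot_adjl.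
by apply: hdot_injr => w; rewrite -adjP !hdot_inclr BA adjP.
Qed.

Lemma hnorm_decomp h k : coincl k = 0 ->
  hnorm (J h + k) ^+ 2 = hnorm h ^+ 2 + hnorm k ^+ 2.
Proof. by move=> k0; rewrite hnorm_sqrD hnorm_incl hdot_incll k0 hdot0r mulr0 addr0. Qed.

Lemma orthocompE k : orthocomp J k <-> coincl k = 0.
Proof.
split=> [hk|k0 h]; last by rewrite hdot_inclr k0 hdot0l.
by apply: hdot_injr => w; rewrite hdot0r -hdot_incll hdotC hk rmorph0.
Qed.

Lemma coincl_perp k : coincl (k - J (coincl k)) = 0.
Proof. by rewrite linearB/= inclK subrr. Qed.

Lemma opnorm_lift (B : bop K K) (A : bop H H) : Defs.lift J B A -> opnorm A <= opnorm B.
Proof.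
move=> /lift_coincl BA; apply: opnorm_le (opnorm_ge0 B) _ => h.
rewrite -{1}(inclK h) -BA; apply: le_trans (hnorm_coincl _) _.
by rewrite -(hnorm_incl h) hnorm_opnorm.
Qed.

Lemma dsum_scalar_lift_exists (Q : bop H H) (q : R[i]) : isometric Q -> `|q| = 1 ->
  exists Qb : bop K K, dsum_scalar J Qb Q q /\ isometric_lift J Qb Q.
Proof.
move=> Qi q1.
pose f k := J (Q (coincl k)) + q *: (k - J (coincl k)).
have f_lin : linear f.
  move=> a x y; rewrite /f !linearP/= (addrACA (a *: x)) -scalerDr.
  by rewrite (scalerDr q) scalerA [q * a]mulrC -scalerA addrACA -scalerDr.
pose fL : {linear K -> K} := HB.pack f (GRing.isLinear.Build _ _ _ _ _ f_lin).
have qperp k : coincl (q *: (k - J (coincl k))) = 0.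
  by rewrite linearZ/= coincl_perp scaler0.
have f_hnorm k : hnorm (fL k) = hnorm k.
  apply/eqP; rewrite -(@eqrXn2 _ 2%N) ?hnorm_ge0//= /f hnorm_decomp//.
  rewrite (isometric_hnorm _ Qi) hnormZ q1 mul1r -hnorm_decomp ?coincl_perp//.
  by rewrite subrKC.
have f_le k : hnorm (fL k) <= 1 * hnorm k by rewrite mul1r f_hnorm.
have [Qb QbE] := bop_of_bounded f_le.
exists Qb; split.
- move=> h k /orthocompE k0.
  have e : coincl (J h + k) = h by rewrite linearD/= k0 addr0 inclK.
  by rewrite QbE /= /f e [J h + k]addrC addrK.
- split; last by move=> k; rewrite QbE !Defs.hnormE f_hnorm.
  by apply/lift_coincl => k; rewrite QbE/= /f linearD/= qperp addr0 inclK.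
Qed.

(** * Existence of the lift *)

(** Here [Xt] is the adjoint of the extension, given by [intertwiner_extension]
with [A = adj V \o Qb], of the adjoint of [X]. *)
Theorem intertwining_lift_exists (T Q X : bop H H) (V Qb : bop K K)
    (q : R[i]) :
  isometric Q -> (forall h, T (X h) = Q (X (T h))) ->
  isometric_lift J V T -> `|q| = 1 ->
  dsum_scalar J Qb Q q -> isometric_lift J Qb Q ->
  exists2 Xt : bop K K, norm_preserving_lift J Xt X &
    forall k, V (Xt k) = Qb (Xt (V k)).
Proof.
move=> Qi TX [Vl Vi] q1 Qb_dsum [_ Qbi].
have Qb_perp k : coincl k = 0 -> Qb k = q *: k.
  by move=> /orthocompE/(Qb_dsum 0); rewrite !linear0 !add0r.
have Qb_incl h : Qb (J h) = J (Q h).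
  by have := Qb_dsum h 0; rewrite scaler0 !addr0; apply; apply/orthocompE/linear0.
have qq : q^* * q = 1 by rewrite mulrC -normCK q1 expr1n.
have coincl_V := (lift_coincl V T).1 Vl.
pose c := opnorm X; have c0 : 0 <= c := opnorm_ge0 X.
pose A : {linear K -> K} := adj V \o Qb.
have A_le k : hnorm (A k) <= hnorm k.
  by rewrite -(isometric_hnorm k Qbi) hnorm_adj_isometric.
(* [N n] is the projection onto [V^n H^perp]. *)
pose N := nat_rect (fun _ => {linear K -> K}) (idfun \- (J \o coincl))
  (fun _ N => V \o (N \o adj V)).
have N_sym n x y : hdot (N n x) y = hdot x (N n y).
  elim: n x y => [|n IH] x y /=; last by rewrite adjP IH hdot_adjl.
  by rewrite hdotBl hdotBr hdot_incll hdot_inclr.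
have N_idem n x : N n (N n x) = N n x.
  elim: n x => [|n IH] x /=; first by rewrite coincl_perp linear0 subr0.
  by rewrite isometric_adjK// IH.
have N_decr n x : N n.+1 (N n x) = N n.+1 x.
  elim: n x => [|n IH] x.
    have -> : N 1%N (N 0%N x) = V (N 0%N (adj V (x - J (coincl x)))) by [].
    rewrite (linearB (adj V)) Vl (linearB (N 0%N)).
    by rewrite [X in _ - X]/= inclK subrr subr0.
  have -> : N n.+2 (N n.+1 x) = V (N n.+1 (adj V (V (N n (adj V x))))) by [].
  by rewrite isometric_adjK// IH.
have coincl_N n k : coincl (N n k) = 0.
  elim: n k => [|n IH] k /=; first exact: coincl_perp.
  by rewrite coincl_V IH linear0.
(* An isometry acting as [q] on [k] has [k] as eigenvector of its adjoint. *)
have Qb_adj k : coincl k = 0 -> adj Qb k = q^* *: k.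
  move=> k0; rewrite -[k in LHS]scale1r -qq -scalerA linearZ/= -Qb_perp//.
  by rewrite isometric_adjK.
pose P n : {linear K -> K} := idfun \- N n.
have PE n k : P n k = k - N n k by [].
have P_sym n x y : hdot (P n x) y = hdot x (P n y).
  by rewrite !PE hdotBl hdotBr N_sym.
have P_idem n x : P n (P n x) = P n x.
  by rewrite !PE (linearB (N n)) N_idem subrr subr0.
have P_incr n x : P n.+1 (P n x) = P n x.
  by rewrite !PE (linearB (N n.+1)) N_decr subrr subr0.
have PA n k : P n (A k) = A (P n.+1 k).
  have NA : N n (A k) = A (N n.+1 k).
    have JVN y : coincl (V (N n y)) = 0 by rewrite coincl_V coincl_N linear0.
    rewrite /A /= (Qb_perp _ (JVN _)) linearZ/= isometric_adjK//; apply: hdot_injr => w.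
    by rewrite -N_sym -adjP -hdot_adjl Qb_adj// hdotZl hdotZr adjP N_sym.
  by rewrite !PE NA (linearB A).
pose Z0 : {linear K -> K} := J \o (adj X \o coincl).
have P0E k : P 0%N k = J (coincl k) by rewrite PE /= opprB subrKC.
have Z0_le k : hnorm (Z0 k) <= c * hnorm (P 0%N k).
  rewrite P0E !hnorm_incl; apply: hnorm_adj_le => // x.
  exact: hnorm_opnorm.
have VZ0 k : adj V (Z0 k) = Z0 (A (P 0%N k)).
  rewrite P0E /= Vl; congr (J _); apply: hdot_injr => w.
  rewrite -(adjP T) -!(adjP X) -[RHS]hdot_incll -(adjP V) Qb_incl hdot_inclr.
  by rewrite coincl_V inclK TX (adjP Q) isometric_adjK.
have [Z [Z_le ZP VZ]] := intertwiner_extension Vi A_le P_sym P_idem P_incr PA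
  c0 Z0_le VZ0.
have [Zb ZbE] := bop_of_bounded Z_le.
pose Xt := adj Zb.
have Xt_lift : Defs.lift J Xt X.
  move=> h; rewrite /Xt adjK ZbE.
  have e : P 0%N (J h) = J h by rewrite P0E inclK.
  by rewrite -[in LHS]e ZP /= inclK.
have coincl_Xt := (lift_coincl Xt X).1 Xt_lift.
have XtV k : Xt (V k) = adj Qb (V (Xt k)).
  apply: hdot_injr => w; rewrite /Xt -(adjP Zb) ZbE -hdot_adjl VZ -ZbE (adjP Zb).
  by rewrite /A /= hdot_adjl adjP.
exists Xt; first split=> //.
  apply/eqP; rewrite eq_le opnorm_lift// andbT.
  apply: opnorm_le => // k; apply: hnorm_adj_le => // y.
  by rewrite ZbE.
move=> k; rewrite XtV.
(* The component of [u] in [H] is [T X h = Q X T h] for [h = coincl k], so that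
   [u] is in the range of [Qb], on which [Qb] inverts its adjoint. *)
set u := V (Xt k).
have uE : u = Qb (J (X (T (coincl k))) + q^* *: (u - J (coincl u))).
  rewrite linearD linearZ/= Qb_incl Qb_perp ?coincl_perp// scalerA qq scale1r.
  by rewrite -TX -coincl_Xt -coincl_V subrKC.
by rewrite {2}uE isometric_adjK.
Qed.

End incl.
End operators_and_lifts.

Theorem theorem4p6 (R : realType) (H : hilbertType R) (T Q X : bop H H)
    (T_contr : contractive T) (Q_isom : isometric Q)
    (TX : forall h : H, T (X h) = Q (X (T h)))
    (K : hilbertType R) (J : inclusion H K) (V : bop K K)
    (V_lift : isometric_lift J V T) :
  (exists Qb Xt : bop K K,
    [/\ isometric_lift J Qb Q, norm_preserving_lift J Xt X &
        forall k : K, V (Xt k) = Qb (Xt (V k))]) /\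
  (forall q : R[i], `|q| = 1 ->
    exists Qb Xt : bop K K,
      [/\ dsum_scalar J Qb Q q, isometric_lift J Qb Q,
          norm_preserving_lift J Xt X &
          forall k : K, V (Xt k) = Qb (Xt (V k))]).
Proof.
have moreover (q : R[i]) : `|q| = 1 -> exists Qb Xt : bop K K,
    [/\ dsum_scalar J Qb Q q, isometric_lift J Qb Q,
        norm_preserving_lift J Xt X &
        forall k : K, V (Xt k) = Qb (Xt (V k))].
  move=> q1; have [Qb [Qb_dsum Qb_lift]] := dsum_scalar_lift_exists J Q_isom q1.
  have [Xt Xt_lift VXt] := intertwining_lift_exists Q_isom TX V_lift q1 Qb_dsum Qb_lift.
  by exists Qb, Xt.
split=> //; have [Qb [Xt [_ Qb_lift Xt_lift VXt]]] := moreover 1 (normr1 _).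
by exists Qb, Xt.
Qed.
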